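(* For all integers $n,k$ with $1 \le n < k <\infty$, we have $$2\, d_{\mathrm{GH}}(S^n, S^k) \le \frac{\pi k}{k+1},\qquad\text{or equivalently}\qquad \pi - 2\, d_{\mathrm{GH}}(S^n, S^k) \ge \frac{\pi}{k+1}.$$
   Context: For an integer $n\ge 1$, $S^n=\{x\in\mathbb{R}^{n+1} : \langle x,x\rangle=1\}$ is the unit sphere equipped with the geodesic metric $d_{S^n}(x,x')=\arccos(\langle x,x'\rangle)$. A correspondence between sets $X$ and $Y$ is a relation $R\subseteq X\times Y$ whose coordinate projections to $X$ and to $Y$ are both surjective. For metric spaces $(X,d_X)$, $(Y,d_Y)$, the distortion of $R$ is $\operatorname{dis}(R)=\sup_{(x,y),(x',y')\in R}|d_X(x,x')-d_Y(y,y')|$. The Gromov--Hausdorff distance between compact metric spaces $X,Y$ is given by $2\,d_{\mathrm{GH}}(X,Y)=\inf_R \operatorname{dis}(R)$, the infimum being over all correspondences $R\subseteq X\times Y$. *)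

(* Defs.v *)
From HB Require Import structures.
From mathcomp Require Import all_boot all_order all_algebra.
From mathcomp Require Import ring lra.
From mathcomp Require Import all_classical all_reals all_analysis.

Set Implicit Arguments.
Unset Strict Implicit.
Unset Printing Implicit Defensive.

Import Order.TTheory GRing.Theory Num.Theory.
Import numFieldNormedType.Exports.

Local Open Scope classical_set_scope.
Local Open Scope ring_scope.

Section Dot.
Context {R : realType} {m : nat}.
Implicit Types u v w : 'rV[R]_m.

Definition dot u v : R := \sum_(i < m) u 0 i * v 0 i.

Lemma dotC u v : dot u v = dot v u.
Proof. by apply: eq_bigr => i _; rewrite mulrC. Qed.

Lemma dotBZl a u v w : dot (u - a *: v) w = dot u w - a * dot v w.
Proof.
rewrite /dot mulr_sumr -sumrB; apply: eq_bigr => i _.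
by rewrite !mxE mulrBl mulrA.
Qed.

Lemma dotBZr a u v w : dot w (u - a *: v) = dot w u - a * dot w v.
Proof. by rewrite dotC dotBZl !(dotC w). Qed.

Lemma dot_ge0 u : 0 <= dot u u.
Proof. by apply: sumr_ge0 => i _; rewrite -expr2 sqr_ge0. Qed.

Lemma dot_eq0 u : dot u u = 0 -> u = 0.
Proof.
move=> /eqP; rewrite psumr_eq0; last by move=> i _; rewrite -expr2 sqr_ge0.
move=> /allP u0; apply/rowP => i; rewrite mxE.
by have := u0 i (mem_index_enum _); rewrite /= mulf_eq0 orbb => /eqP.
Qed.

Lemma dot_CauchySchwarz u v : dot u v ^+ 2 <= dot u u * dot v v.
Proof.
have [v0|v_neq0] := eqVneq (dot v v) 0.
  rewrite v0 mulr0 (dot_eq0 v0) /dot big1 ?expr0n// => i _.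
  by rewrite mxE mulr0.
have vgt0 : 0 < dot v v by rewrite lt_def v_neq0 dot_ge0.
have := dot_ge0 (u - (dot u v / dot v v) *: v).
rewrite dotBZl !dotBZr (dotC v u).
rewrite (_ : _ - _ = dot u u - dot u v ^+ 2 / dot v v); last by field.
by rewrite subr_ge0 ler_pdivrMr.
Qed.

End Dot.

Record sphere (R : realType) (n : nat) := Sphere {
  sphere_val :> 'rV[R]_n.+1;
  sphereP : dot sphere_val sphere_val == 1 }.

HB.instance Definition _ R n := [isSub for @sphere_val R n].
HB.instance Definition _ R n := [Choice of sphere R n by <:].

Section GeodesicMetric.
Context {R : realType} {n : nat}.
Implicit Types x y z : sphere R n.

Definition geodesic_dist x y : R := acos (dot x y).

Lemma sphere_dotxx x : dot x x = 1.
Proof. exact/eqP/sphereP. Qed.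

Lemma sphere_dot_bound x y : -1 <= dot x y <= 1.
Proof.
rewrite -ler_norml -(@ler_pXn2r _ 2)// ?nnegrE// expr1n real_normK ?num_real//.
by have := dot_CauchySchwarz x y; rewrite !sphere_dotxx mulr1.
Qed.

Let distxx x : geodesic_dist x x = 0.
Proof. by rewrite /geodesic_dist sphere_dotxx acos1. Qed.

Let dist_pos x y : geodesic_dist x y = 0 -> x = y.
Proof.
move=> /(congr1 cos); rewrite cos0 acosK ?in_itv/= ?sphere_dot_bound// => xy1.
apply/val_inj/eqP; rewrite -subr_eq0 -[X in _ - X]scale1r; apply/eqP/dot_eq0.
rewrite dotBZl !dotBZr (dotC (\val y) (\val x)) !sphere_dotxx.
rewrite [dot _ _]xy1; ring.
Qed.

Let dist_sym x y : geodesic_dist x y = geodesic_dist y x.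
Proof. by rewrite /geodesic_dist dotC. Qed.

Let dist_triangle y x z :
  geodesic_dist x z <= geodesic_dist x y + geodesic_dist y z.
Proof.
rewrite /geodesic_dist.
set a := dot x y; set b := dot y z; set c := dot x z.
have aB : -1 <= a <= 1 := sphere_dot_bound x y.
have bB : -1 <= b <= 1 := sphere_dot_bound y z.
have cB : -1 <= c <= 1 := sphere_dot_bound x z.
have [|lt_pi] := leP pi (acos a + acos b); first exact/le_trans/acos_lepi.
rewrite leNgt; apply/negP => lt_c.
have sum_ge0 : 0 <= acos a + acos b by rewrite addr_ge0// acos_ge0.
have : cos (acos c) < cos (acos a + acos b).
  by rewrite ltr_cos ?in_itv/= ?acos_ge0 ?acos_lepi// sum_ge0 ltW.
rewrite cosD !acosK ?in_itv//= !sin_acos//.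
have a1 : 0 <= 1 - a ^+ 2 by case/andP: aB => *; nra.
have b1 : 0 <= 1 - b ^+ 2 by case/andP: bB => *; nra.
rewrite -sqrtrM// ltNge => /negP; apply.
have := dot_CauchySchwarz (sphere_val x - a *: sphere_val y)
                          (sphere_val z - b *: sphere_val y).
rewrite !dotBZl !dotBZr !sphere_dotxx !(dotC y x) !(dotC z y) -/a -/b -/c.
move=> CS.
have /ler_wsqrtr : (a * b - c) ^+ 2 <= (1 - a ^+ 2) * (1 - b ^+ 2).
  by apply: le_trans (le_trans CS _); rewrite le_eqVlt; apply/orP; left;
    apply/eqP; ring.
rewrite sqrtr_sqr => /(le_trans (ler_norm _)); lra.
Qed.

HB.instance Definition _ := isMetric.Build R (sphere R n)
  distxx dist_pos dist_sym dist_triangle.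

Lemma mdist_sphereE x y : mdist x y = acos (dot x y).
Proof. by []. Qed.

End GeodesicMetric.

Section GromovHausdorff.
Context {R : realType}.
Local Open Scope ereal_scope.

Definition correspondence {X Y : Type} (C : set (X * Y)) : Prop :=
  fst @` C = [set: X] /\ snd @` C = [set: Y].

(* The supremum is taken in the extended reals, where sup set0 = -oo; a
   correspondence is empty only when both spaces are. *)
Definition distortion {X Y : metricType R} (C : set (X * Y)) : \bar R :=
  ereal_sup [set `|mdist p.1 q.1 - mdist p.2 q.2|%R%:E | p in C & q in C].

Definition dGH (X Y : metricType R) : \bar R :=
  2^-1%:E * ereal_inf [set distortion C | C in @correspondence X Y].

End GromovHausdorff.

(* Main.v *)
(* Put m = k + 1 and h = pi / m.  The m lines of a plane spanned by the points
   p_i at angles i * h pairwise form angles at least h, and sqrt (2 / m) times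
   these points are the columns of a matrix with two orthonormal rows.
   Completing the rows to an orthonormal family gives a linear isometry g of S^n
   into S^k such that <g p_i, e_i> = sqrt (2 / m) for the standard basis (e_i).
   The correspondence pairs every x with g x, and e *: p_i (with e = 1 or -1)
   with every y in S^k such that e * y_i >= 1 / sqrt m.  If u_i >= 1 / sqrt m and
   v_i <= - 1 / sqrt m, then |u - v|^2 >= 4 / m, so <u, v> <= 1 - 2 / m <= cos h
   and d(u, v) >= h.  Hence antipodal values of the second kind have preimages at
   distance at least h, equal values have preimages at distance at most pi - h,
   and all other values are at a distance in [h, pi - h]; similarly
   d(g (e *: p_i), y) <= pi - h, which by the triangle inequality bounds the
   distortion between pairs of different kinds. *)
Require Import Defs.
From mathcomp Require Import all_boot all_order all_algebra.
From mathcomp Require Import ring lra.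
From mathcomp Require Import all_classical all_reals all_analysis.
Import Order.TTheory GRing.Theory Num.Theory.
Local Open Scope ring_scope.

(** * Bounds and sums of sines and cosines *)

Section Trigonometry.
Set Implicit Arguments.
Unset Strict Implicit.
Context {R : realType}.
Implicit Types x y h a b : R.

Lemma le_cos_pi x y : 0 <= x -> x <= y -> y <= pi -> cos y <= cos x.
Proof.
move=> x0; rewrite le_eqVlt => /orP[/eqP->//|xy] ypi.
by rewrite ltW// ltr_cos ?in_itv/= ?x0 ?ypi ?andbT//; lra.
Qed.

Lemma norm_cos_le h y : 0 <= h -> h <= y <= pi - h -> `|cos y| <= cos h.
Proof.
move=> h0 /andP[hy yh]; rewrite ler_norml le_cos_pi//; last lra.
have -> : - cos h = cos (pi - h) by rewrite cosB cospi sinpi; ring.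
by rewrite le_cos_pi//; lra.
Qed.

(** From [|cos y| <= cos x], as both sines are nonnegative. *)
Lemma le_sin_pi x y : 0 <= x -> x <= y <= pi - x -> sin x <= sin y.
Proof.
move=> x0 xy; have c := norm_cos_le x0 xy.
have sx : 0 <= sin x by rewrite sin_ge0_pi//; lra.
have sy : 0 <= sin y by rewrite sin_ge0_pi//; lra.
rewrite -ler_sqr ?nnegrE// !sin2cos2 lerB//.
by rewrite -(real_normK (num_real (cos y))) lerXn2r ?nnegrE//; apply: le_trans c.
Qed.

Lemma acos_ge h a : 0 <= h <= pi -> -1 <= a <= 1 -> a <= cos h -> h <= acos a.
Proof.
move=> hpi a1; rewrite leNgt => ah; rewrite leNgt; apply: contra ah => ah.
rewrite -[ltRHS](@acosK _ a) ?in_itv//= ltr_cos ?in_itv//= ?acos_ge0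
  ?acos_lepi//.
Qed.

Lemma acos_le h a :
  0 <= h <= pi -> -1 <= a <= 1 -> - cos h <= a -> acos a <= pi - h.
Proof.
move=> hpi a1 ha; have := @acos_ge h (- a) hpi.
by rewrite acosN// => H; have := H ltac:(lra) ltac:(lra); lra.
Qed.

(** Telescoping: [2 * sin b * cos y] is [sin (y + b) - sin (y - b)]. *)
Lemma sum_cos_arith a b m :
  2 * sin b * (\sum_(j < m) cos (a + 2 * j%:R * b)) =
  sin (a + (2 * m%:R - 1) * b) - sin (a - b).
Proof.
elim: m => [|m IH].
  by rewrite big_ord0 !mulr0 sub0r mulN1r subrr.
rewrite big_ord_recr mulrDr IH /= -[m.+1]addn1 natrD.
set y := a + 2 * m%:R * b.
have -> : a + (2 * (m%:R + 1) - 1) * b = y + b by rewrite /y; ring.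
have -> : a + (2 * m%:R - 1) * b = y - b by rewrite /y; ring.
rewrite (sinD y b) (sinB y b); ring.
Qed.

(** The telescoped ends differ by a full turn, while [1 < m] keeps [sin (pi / m)] nonzero. *)
Lemma sum_cos_circle a m : (1 < m)%N ->
  \sum_(j < m) cos (a + 2 * j%:R * (pi / m%:R)) = 0.
Proof.
move=> m1; have m0 : 0 < m%:R :> R by rewrite ltr0n ltnW.
have m1R : 1 < m%:R :> R by rewrite ltr1n.
have := sum_cos_arith a (pi / m%:R) m.
have -> : a + (2 * m%:R - 1) * (pi / m%:R) = (a - pi / m%:R) + pi *+ 2.
  by field; rewrite gt_eqF.
rewrite sinD2pi subrr => /eqP; rewrite !mulf_eq0 pnatr_eq0/= => /orP[|/eqP//].
rewrite gt_eqF// sin_gt0_pi// divr_gt0 ?pi_gt0//= ltr_pdivrMr//.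
by rewrite ltr_pMr// pi_gt0.
Qed.

(* The increments of [sin ^+ 2] on the grid [j * x], for [x] the [m]-th part of
   the right angle, are [sin x * sin ((2 * j + 1) * x) >= sin x ^+ 2]. *)
Lemma cos_pi_div_ge m : (0 < m)%N -> 1 - 2 / m%:R <= cos (pi / m%:R) :> R.
Proof.
move=> m_gt0; have m0 : 0 < m%:R :> R by rewrite ltr0n.
have pi0 := @pi_gt0 R.
pose x : R := pi / (2 * m%:R).
have x0 : 0 < x by rewrite /x divr_gt0// mulr_gt0.
have mx : 2 * m%:R * x = pi by rewrite /x; field; rewrite gt_eqF.
have -> : pi / m%:R = x *+ 2 by rewrite /x; field; rewrite gt_eqF.
(* With this offset the terms become [sin ((2 * j + 1) * x)] and the telescoped right-hand side
   equals 2. *)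
have := sum_cos_arith (x - pi / 2) x m.
have -> : x - pi / 2 + (2 * m%:R - 1) * x = pi / 2 by rewrite mulrBl mx; field.
have -> : x - pi / 2 - x = - (pi / 2) by ring.
rewrite sinN sin_pihalf => sumE.
have sx0 : 0 <= sin x.
  rewrite sin_ge0_pi// (ltW x0)/= -mx ler_peMl ?(ltW x0)//.
  by rewrite -natrM ler1n muln_gt0.
have : m%:R * sin x <= \sum_(j < m) cos (x - pi / 2 + 2 * j%:R * x).
  rewrite mulr_natl -[m in _ *+ m]card_ord -sumr_const ler_sum// => j _.
  have -> : x - pi / 2 + 2 * j%:R * x = (2 * j%:R + 1) * x - pi / 2 by ring.
  rewrite cosBpihalf le_sin_pi ?(ltW x0)// -[X in X - x]mx.
  have : j.+1%:R <= m%:R :> R by rewrite ler_nat.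
  rewrite -[j.+1]addn1 natrD => jm; have : 0 <= j%:R :> R by [].
  nra.
move=> /(ler_wpM2l sx0) le1.
rewrite cos_mulr2n cos2sin2 lerBlDr -lerBlDl ler_pdivlMr//.
nra.
Qed.

End Trigonometry.

(** * Orthonormal rows and linear isometries *)

Section LinearIsometries.
Set Implicit Arguments.
Unset Strict Implicit.
Context {R : realType}.

Lemma dotE m (u v : 'rV[R]_m) : dot u v = (u *m v^T) 0 0.
Proof. by rewrite mxE; apply: eq_bigr => i _; rewrite mxE. Qed.

Lemma dotZl m a (u v : 'rV[R]_m) : dot (a *: u) v = a * dot u v.
Proof. by rewrite !dotE -scalemxAl mxE. Qed.

Lemma dotZr m a (u v : 'rV[R]_m) : dot u (a *: v) = a * dot u v.
Proof. by rewrite dotC dotZl dotC. Qed.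

Lemma dot_mulmx m p (A : 'M[R]_(m, p)) (u v : 'rV_m) :
  A *m A^T = 1%:M -> dot (u *m A) (v *m A) = dot u v.
Proof. by move=> AA; rewrite !dotE trmx_mul mulmxA -(mulmxA u) AA mulmx1. Qed.

Lemma exists_unit_orthogonal r N (B : 'M[R]_(r, N)) : (r < N)%N ->
  exists w : 'rV_N, dot w w = 1 /\ w *m B^T = 0.
Proof.
move=> rN; have : kermx B^T != 0.
  by rewrite -mxrank_eq0 mxrank_ker subn_eq0 -ltnNge (leq_ltn_trans (rank_leq_col _)).
case/rowV0Pn => w /sub_kermxP wB w0.
have ww : 0 < dot w w.
  by rewrite lt_def dot_ge0 andbT; apply: contra w0 => /eqP/dot_eq0/eqP.
exists ((Num.sqrt (dot w w))^-1 *: w); split; last by rewrite -scalemxAl wB scaler0.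
rewrite dotZl dotZr mulrA -invfM -expr2 sqr_sqrtr ?dot_ge0// mulVf//.
by rewrite gt_eqF.
Qed.

Lemma orthonormal_extension d r N (B : 'M[R]_(r, N)) : (r + d <= N)%N ->
  B *m B^T = 1%:M ->
  exists A : 'M[R]_(d, N), col_mx B A *m (col_mx B A)^T = 1%:M.
Proof.
move=> rdN BB.
suff [A [AA AB]] : exists A : 'M[R]_(d, N), A *m A^T = 1%:M /\ A *m B^T = 0.
  exists A; rewrite tr_col_mx mul_col_row BB AA AB.
  by rewrite -[B *m A^T]trmxK trmx_mul trmxK AB trmx0 -scalar_mx_block.
(* The new unit vector joins [B] before the induction hypothesis is applied, so that the remaining
   rows come out orthogonal to it; hence the generalization over [B]. *)
elim: d r B rdN BB => [|d IH] r B rdN BB.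
  by exists 0; split; [apply/matrixP => -[] | rewrite mul0mx].
have rN : (r < N)%N by rewrite (leq_trans _ rdN)// addnS ltnS leq_addr.
have [w [ww wB]] := exists_unit_orthogonal B rN.
have wwE : w *m w^T = 1%:M by rewrite [LHS]mx11_scalar -dotE ww.
have Bw : B *m w^T = 0 by rewrite -[LHS]trmxK trmx_mul trmxK wB trmx0.
have [||A [AA AC]] := IH (1 + r)%N (col_mx w B).
- by rewrite add1n addSn -addnS.
- by rewrite tr_col_mx mul_col_row wwE wB Bw BB -scalar_mx_block.
move: AC; rewrite tr_col_mx mul_mx_row -[RHS]row_mx0 => /eq_row_mx[Aw AB].
have wA : w *m A^T = 0 by rewrite -[LHS]trmxK trmx_mul trmxK Aw trmx0.
have wAB : col_mx w A *m B^T = 0 by rewrite mul_col_mx wB AB col_mx0.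
have wAwA : col_mx w A *m (col_mx w A)^T = 1%:M.
  by rewrite tr_col_mx mul_col_row wwE Aw wA AA -scalar_mx_block.
by exists (col_mx w A).
Qed.

(* The point (cos t, sin t), in the form that suits product-to-sum formulas. *)
Definition circle_point (t : R) : 'rV[R]_2 :=
  \row_(s < 2) cos (t - s%:R * (pi / 2)).

Lemma dot_circle_point t t' : dot (circle_point t) (circle_point t') = cos (t - t').
Proof.
rewrite /dot !big_ord_recl big_ord0 !mxE /= !mul0r !subr0 !mul1r !cosBpihalf addr0.
by rewrite cosB.
Qed.

Definition circle_frame m : 'M[R]_(2, m) :=
  \matrix_(s, j) (Num.sqrt (2 / m%:R) * circle_point (j%:R * (pi / m%:R)) 0 s).

Lemma circle_frame_orthonormal m : (1 < m)%N ->
  circle_frame m *m (circle_frame m)^T = 1%:M.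
Proof.
move=> m1; have m0 : m%:R != 0 :> R by rewrite pnatr_eq0 -lt0n ltnW.
apply/matrixP => s t; rewrite !mxE.
set u := s%:R * (pi / 2) : R; set v := t%:R * (pi / 2) : R.
(* Product-to-sum: the first cosines sum to 0, and the second is constant in [j], equal to 1 if
   [s = t] and to 0 otherwise. *)
transitivity (\sum_(j < m) m%:R^-1 *
    (cos (- (u + v) + 2 * j%:R * (pi / m%:R)) + cos (v - u))).
  apply: eq_bigr => j _; rewrite !mxE -/u -/v mulrACA -expr2 sqr_sqrtr; last first.
    by rewrite divr_ge0.
  set y := j%:R * _.
  have -> : - (u + v) + 2 * j%:R * (pi / m%:R) = (y - u) + (y - v) by rewrite /y; ring.
  have -> : v - u = (y - u) - (y - v) by ring.
  by rewrite (cosD (y - u)) (cosB (y - u)); field.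
rewrite -mulr_sumr big_split/= sum_cos_circle// add0r sumr_const card_ord.
rewrite -[cos _ *+ _]mulr_natl mulKf// {}/u {}/v.
by case: s => -[|[|//]] ?; case: t => -[|[|//]] ?;
  rewrite /= ?mul0r ?mul1r ?subrr ?subr0 ?sub0r ?cosN ?cos0 ?cos_pihalf.
Qed.

(** Column [i] of the frame is [Num.sqrt (2 / m)] times the unit vector being mapped. *)
Lemma mul_circle_frame m (i : 'I_m) :
  (circle_point (i%:R * (pi / m%:R)) *m circle_frame m) 0 i = Num.sqrt (2 / m%:R).
Proof.
set q := circle_point _; have <- : Num.sqrt (2 / m%:R) * dot q q = Num.sqrt (2 / m%:R).
  by rewrite dot_circle_point subrr cos0 mulr1.
rewrite mxE /dot mulr_sumr; apply: eq_bigr => s _.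
by rewrite [X in _ * X]mxE -/q; ring.
Qed.


(** The squared distance [2 - 2 * dot u v] is at least the square of the coordinate gap, which is at
    least [2 * r]. *)
Lemma dot_opposite_coord m (u v : 'rV[R]_m) (i : 'I_m) (r : R) :
  dot u u = 1 -> dot v v = 1 -> 0 <= r -> r <= u 0 i -> v 0 i <= - r ->
  dot u v <= 1 - 2 * r ^+ 2.
Proof.
move=> uu vv r0 ru vr.
have : (u 0 i - v 0 i) ^+ 2 <= dot (u - 1 *: v) (u - 1 *: v).
  rewrite /dot (bigD1 i)//= !mxE mul1r -expr2 lerDl.
  by apply: sumr_ge0 => j _; rewrite -expr2 sqr_ge0.
rewrite dotBZl !dotBZr (dotC v u) uu vv; nra.
Qed.

(** Otherwise [m] squares, each below [1 / m], would sum to less than 1. *)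
Lemma large_coordinate m (u : 'rV[R]_m) : (0 < m)%N -> dot u u = 1 ->
  exists i, Num.sqrt (m%:R^-1) <= `|u 0 i|.
Proof.
move=> m0 uu; apply: contrapT => /forallNP small.
have : \sum_(i < m) u 0 i * u 0 i < \sum_(i < m) m%:R^-1.
  apply: ltr_sum => [|i _]; last first.
    rewrite -expr2 -ltr_sqrt ?invr_gt0 ?ltr0n// sqrtr_sqr ltNge.
    exact/negP/small.
  by apply/hasP; exists (Ordinal m0); rewrite ?mem_index_enum.
rewrite [X in X < _]uu sumr_const card_ord -[_ *+ m]mulr_natr mulVf ?ltxx//.
by rewrite pnatr_eq0 -lt0n.
Qed.

Lemma exists_isometry_circle_frame n k : (1 <= n)%N -> (n < k)%N ->
  exists (A : 'M[R]_(n.+1, k.+1)) (p : 'I_k.+1 -> 'rV_n.+1),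
  [/\ A *m A^T = 1%:M, forall i, dot (p i) (p i) = 1,
      forall i j, i != j -> `|dot (p i) (p j)| <= cos (pi / k.+1%:R)
    & forall i, (p i *m A) 0 i = Num.sqrt (2 / k.+1%:R)].
Proof.
(* The dimension becomes [2 + n]: two circle rows and [n] completing ones. *)
case: n => [//|n] _ nk.
have [|A AA] := @orthonormal_extension n 2 _ _ (leqW nk) (@circle_frame_orthonormal k.+1 _).
  by rewrite ltnS (leq_ltn_trans _ nk).
(* Zero padding lets only the circle rows act on [p i]. *)
pose p (i : 'I_k.+1) : 'rV[R]_(2 + n) :=
  row_mx (circle_point (i%:R * (pi / k.+1%:R))) 0.
have pp i j : dot (p i) (p j) = cos ((i%:R - j%:R) * (pi / k.+1%:R)).
  rewrite dotE tr_row_mx mul_row_col mul0mx addr0 -dotE dot_circle_point.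
  by rewrite mulrBl.
have pA i : (p i *m col_mx (circle_frame k.+1) A) 0 i = Num.sqrt (2 / k.+1%:R).
  by rewrite mul_row_col mul0mx addr0 mul_circle_frame.
exists (col_mx (circle_frame k.+1) A), p; split => //.
- by move=> i; rewrite pp subrr mul0r cos0.
- move=> i j; wlog ij : i j / (j < i)%N => [H|_].
    rewrite neq_ltn => /orP[] ij; last by apply: H => //; rewrite -val_eqE gtn_eqF.
    by rewrite dotC; apply: H => //; rewrite -val_eqE gtn_eqF.
  rewrite pp -natrB ?(ltnW ij)//.
  have k0 : 0 < k.+1%:R :> R by [].
  rewrite norm_cos_le ?divr_ge0 ?pi_ge0//.
  set h := pi / _; have h0 : 0 <= h by rewrite divr_ge0 ?pi_ge0.
  (* As [0 < i - j <= k], the angle [(i - j) * h] lies between [h] and [k * h]. *)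
  have -> : pi - h = k%:R * h by rewrite /h -[k.+1]addn1 natrD; field; rewrite natr1 gt_eqF.
  rewrite ler_peMl ?ler1n ?subn_gt0//= ler_wpM2r// ler_nat.
  by rewrite leq_subLR (leq_trans _ (leq_addl _ _))// -ltnS.
Qed.

End LinearIsometries.

(** * The correspondence and its distortion *)

Lemma dGH_le (R : realType) (X Y : metricType R) (C : set (X * Y)) (c : R) :
  correspondence C ->
  (forall p q, C p -> C q -> `|mdist p.1 q.1 - mdist p.2 q.2| <= c) ->
  (2%:E * dGH X Y <= c%:E)%E.
Proof.
move=> corrC le_c; rewrite /dGH muleA -EFinM divff// mul1e.
apply: (@le_trans _ _ (distortion C)).
  by apply: ereal_inf_lbound; exists C.
by apply: ge_ereal_sup => _ [p Cp [q Cq <-]]; rewrite lee_fin le_c.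
Qed.

Theorem theorem1p2 (R : realType) (n k : nat) (hn : (1 <= n)%N) (hnk : (n < k)%N) :
  (2%:E * dGH (sphere R n) (sphere R k) <= (pi * k%:R / k.+1%:R)%:E)%E /\
  ((pi / k.+1%:R)%:E <= pi%:E - 2%:E * dGH (sphere R n) (sphere R k))%E.
Proof.
have hE : pi * k%:R / k.+1%:R = pi - pi / k.+1%:R :> R.
  by rewrite -natr1; field; rewrite natr1.
suff le1 : (2%:E * dGH (sphere R n) (sphere R k) <= (pi * k%:R / k.+1%:R)%:E)%E.
  split => //; have -> : pi / k.+1%:R = pi - pi * k%:R / k.+1%:R :> R.
    by rewrite hE; ring.
  by rewrite EFinB leeB.
rewrite hE; set h := pi / k.+1%:R.
have hpi : 0 <= h <= pi.
  by rewrite divr_ge0 ?pi_ge0//= ler_pdivrMr// ler_peMr ?pi_ge0// ler1n.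
have cosh : 1 - 2 * Num.sqrt (k.+1%:R^-1) ^+ 2 <= cos h.
  by rewrite sqr_sqrtr ?invr_ge0// cos_pi_div_ge.
set r := Num.sqrt _ in cosh.
have r0 : 0 <= r by exact: sqrtr_ge0.
have [A [p [AA pp1 pp pA]]] := @exists_isometry_circle_frame R n k hn hnk.
have sq1 (e : R) (m : nat) (u : 'rV[R]_m) : e ^+ 2 = 1 -> dot u u = 1 ->
    dot (e *: u) (e *: u) = 1.
  by move=> e1 u1; rewrite dotZl dotZr mulrA -expr2 e1 u1 mulr1.
pose C := [set xy : sphere R n * sphere R k |
  (xy.2 : 'rV[R]_k.+1) = (xy.1 : 'rV[R]_n.+1) *m A \/
  exists i e, [/\ e ^+ 2 = 1, (xy.1 : 'rV[R]_n.+1) = e *: p i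
                & r <= e * (xy.2 : 'rV[R]_k.+1) 0 i]]%classic.
have dotA (x x' : 'rV[R]_n.+1) : dot (x *m A) (x' *m A) = dot x x'.
  exact: dot_mulmx.
pose g (x : sphere R n) : sphere R k :=
  Sphere (introT eqP (etrans (dotA x x) (sphere_dotxx x))).
have gE x x' : mdist (g x) (g x') = mdist x x' :> R.
  by rewrite !mdist_sphereE /= dotA.
have opp i (y y' : 'rV[R]_k.+1) : dot y y = 1 -> dot y' y' = 1 ->
    r <= y 0 i -> y' 0 i <= - r -> dot y y' <= cos h.
  by move=> yy yy' ry ry'; apply: le_trans (dot_opposite_coord yy yy' r0 ry ry') cosh.
apply: (@dGH_le _ _ _ C).
  split; apply/seteqP; split => // z _.
    by exists (z, g z) => //; left.
  (* Surjectivity onto the larger sphere: [e] is the sign of a large coordinate of [z]. *)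
  have [i] := large_coordinate (ltn0Sn k) (sphere_dotxx z).
  rewrite -/r => ri.
  pose e : R := if 0 <= (z : 'rV[R]_k.+1) 0 i then 1 else -1.
  have ee : e ^+ 2 = 1 by rewrite /e; case: ifP; rewrite ?sqrrN expr1n.
  exists (Sphere (introT eqP (sq1 _ _ _ ee (pp1 i))), z) => //.
  right; exists i, e; split => //=; apply: le_trans ri _.
  rewrite /e; case: ifPn => [|/negbTE] z0; first by rewrite mul1r ger0_norm.
  by rewrite mulN1r ltr0_norm// ltNge z0.
have dist_g (x : sphere R n) (y : sphere R k) i e : e ^+ 2 = 1 ->
    (x : 'rV[R]_n.+1) = e *: p i -> r <= e * (y : 'rV[R]_k.+1) 0 i ->
    mdist (g x) y <= pi - h.
  move=> ee xE ry; rewrite mdist_sphereE acos_le ?sphere_dot_bound//.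
  (* The sign moves to [y], and [opp] is applied to the image of [p i] and to [- e *: y]. *)
  rewrite /= xE -scalemxAl dotZl -dotZr lerNl -[- dot _ _]mulN1r -dotZr.
  apply: (opp i); rewrite ?dotA ?sq1 ?sqrrN ?expr1n ?sphere_dotxx//.
    by rewrite pA ler_sqrt ?divr_ge0// -[leLHS]mul1r ler_wpM2r// ler1n.
  by rewrite !mxE mulN1r lerN2.
have cross (x x' : sphere R n) (y y' : sphere R k) i e : e ^+ 2 = 1 ->
    (x : 'rV[R]_n.+1) = e *: p i -> r <= e * (y : 'rV[R]_k.+1) 0 i ->
    (y' : 'rV[R]_k.+1) = (x' : 'rV[R]_n.+1) *m A ->
    `|mdist x x' - mdist y y'| <= pi - h.
  move=> ee xE ry y'E; have -> : y' = g x' by apply: val_inj.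
  apply: le_trans (dist_g _ _ _ _ ee xE ry); rewrite -gE ler_distl.
  have t1 := metric_triangle y (g x) (g x').
  have t2 := metric_triangle (g x) y (g x').
  rewrite [mdist y (g x)]metric_sym in t1.
  by apply/andP; split; lra.
move=> [x y] [x' y'] /= [yE|[i [e [ee xE ry]]]] [y'E|[j [e' [ee' x'E ry']]]].
- rewrite (_ : y = g x) 1?(_ : y' = g x'); try exact: val_inj.
  by rewrite gE subrr normr0; lra.
- rewrite (metric_sym x) (metric_sym y).
  exact: cross ee' x'E ry' yE.
- exact: cross ee xE ry y'E.
rewrite !mdist_sphereE xE x'E.
set b := dot y y'; have bb : -1 <= b <= 1 := sphere_dot_bound y y'.
have acosb0 := acos_ge0 bb; have acosbpi := acos_lepi bb.
(* For distinct indices the distance on the smaller sphere is in [[h, pi - h]] and the other one in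
   [[0, pi]], so they differ by at most [pi - h]. *)
have [ij|ij] := eqVneq i j; last first.
  have a1 : `|dot (e *: p i) (e' *: p j)| <= cos h.
    rewrite dotZl dotZr !normrM.
    have norm1 (t : R) : t ^+ 2 = 1 -> `|t| = 1.
      by move=> t1; apply/eqP; rewrite -sqrp_eq1// real_normK ?num_real// t1.
    by rewrite (norm1 e)// (norm1 e')// !mul1r pp.
  move: a1; set a := dot _ _; rewrite ler_norml => /andP[a1 a2].
  have aa : -1 <= a <= 1.
    by rewrite (le_trans _ a1) ?(le_trans a2)// ?cos_le1// lerN2 cos_le1.
  have := acos_ge hpi aa a2; have := acos_le hpi aa a1.
  by rewrite ler_norml => *; apply/andP; split; lra.
subst j; rewrite dotZl dotZr pp1 mulr1.
(* This follows from [opp] for [e *: y] and [- e' *: y']. Equal signs then give distances 0 and at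
   most [pi - h]; opposite signs give [pi] and at least [h]. *)
have eb : - cos h <= (e * e') * b.
  have := @opp i (e *: (y : 'rV[R]_k.+1)) (- e' *: (y' : 'rV[R]_k.+1)).
  rewrite !sq1 ?sqrrN ?sphere_dotxx// !mxE mulNr lerN2 dotZl dotZr.
  by move=> /(_ erefl erefl ry ry'); rewrite -/b; lra.
have : (e * e') ^+ 2 == 1 by rewrite exprMn ee ee' mulr1.
rewrite sqrf_eq1 => /orP[] /eqP ss; rewrite ss in eb *.
  by rewrite acos1 sub0r normrN ger0_norm// acos_le//; lra.
rewrite acosN1 ger0_norm; last by lra.
have : h <= acos b by rewrite acos_ge//; lra.
lra.
Qed.
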